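(* Let $N \ge 2$ and $T > 4$, let $\alpha = \frac{1}{\log T}$ and $$\eta = \left(\frac{4NT}{\alpha(1-\alpha)\sqrt{2\log N}}\right)^{1/(2-\alpha)}.$$ Run GBPA with the stochastically smoothed potential whose perturbation is $\eta Z$ with $Z$ a standard Gaussian random variable. Then for every sequence of gain vectors $g_1,\dots,g_T \in [-1,0]^N$ the expected regret is at most $$96\sqrt{NT}\, N^{1/\log T}\sqrt{\log N}\,\log T .$$ If moreover $T > N$, the expected regret is at most $278\sqrt{NT}\sqrt{\log N}\,\log T$.
   Context: Adversarial multi-armed bandit: there are $N$ arms and $T$ rounds; an oblivious adversary fixes gain vectors $g_1,\dots,g_T \in [-1,0]^N$ in advance. For a random variable $W$ with a continuous distribution on $\mathbb{R}$ and finite expectation, the stochastically smoothed potential is $\tilde\Phi(G) = \mathbb{E}[\max_{i}(G_i + W_i)]$ for $G\in\mathbb{R}^N$, where $W_1,\dots,W_N$ are i.i.d. copies of $W$; it is convex and differentiable with $\nabla_i\tilde\Phi(G) = \mathbb{P}(i = \arg\max_j (G_j+W_j))$, so $\nabla\tilde\Phi(G)$ lies in the probability simplex. ''Perturbation $\eta Z$'' means $W = \eta Z$. The algorithm GBPA$(\tilde\Phi)$: set $\hat G_0 = 0$; for $t=1,\dots,T$: let $p_t = \nabla\tilde\Phi(\hat G_{t-1})$, draw arm $i_t \sim p_t$, observe only $g_{t,i_t}$, set $\hat g_t = \frac{g_{t,i_t}}{p_{t,i_t}} e_{i_t}$ ($e_i$ the $i$-th standard basis vector) and $\hat G_t = \hat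 G_{t-1} + \hat g_t$. The expected regret is $\mathbb{E}\big[\max_{i}\sum_{t=1}^T (g_{t,i} - g_{t,i_t})\big]$, the expectation being over the learner's random choices. $\log$ denotes the natural logarithm. *)

(* Defs.v *)
From HB Require Import structures.
From mathcomp Require Import all_boot all_order all_algebra.
From mathcomp Require Import all_classical all_reals all_analysis.
Set Implicit Arguments. Unset Strict Implicit. Unset Printing Implicit Defensive.
Import Order.TTheory GRing.Theory Num.Theory.
Local Open Scope classical_set_scope.
Local Open Scope ring_scope.

Section bandit.
Context {R : realType}.

(* Expectation of a nonnegative functional h of n i.i.d. standard Gaussian
   random variables Z_0,...,Z_{n-1}, written as the iterated integral against
   the standard normal law (= integral against the n-fold product law, by
   Tonelli).  The sample (z_0,...,z_{n-1}) is passed to h as the list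
   [:: z_0; ...; z_{n-1}]. *)
Fixpoint gauss_expect (n : nat) (h : seq R -> \bar R) : \bar R :=
  match n with
  | 0 => h [::]
  | n'.+1 => (\int[normal_prob (0 : R) 1]_z gauss_expect n' (fun w => h (z :: w)))%E
  end.

Variable N : nat.

(* gradient of the stochastically smoothed potential with perturbation eta*Z :
   grad_i Phi~(G) = P(i = argmax_j (G_j + eta Z_j))   (ties have probability 0) *)
Definition smoothed_grad (eta : R) (G : 'I_N -> R) (i : 'I_N) : R :=
  fine (gauss_expect N (fun w =>
    (if [forall j : 'I_N, (j != i) ==>
          (G j + eta * nth 0 w j < G i + eta * nth 0 w i)] then 1 else 0)%:E)).

Variable T : nat.

(* estimated cumulative gain vector \hat G_t (after t rounds), along the
   history f : {ffun 'I_T -> 'I_N} of chosen arms (f u = arm chosen at round u+1) *)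
Fixpoint gbpa_Ghat (eta : R) (g : 'I_T -> 'I_N -> R) (f : {ffun 'I_T -> 'I_N})
    (t : nat) : 'I_N -> R :=
  match t with
  | 0 => fun _ => 0
  | t'.+1 =>
      let G := gbpa_Ghat eta g f t' in
      match (insub t' : option 'I_T) with
      | Some u => fun j =>
          G j + (if f u == j then g u j / smoothed_grad eta G j else 0)
      | None => G
      end
  end.

Definition gbpa_prob (eta : R) (g : 'I_T -> 'I_N -> R)
    (f : {ffun 'I_T -> 'I_N}) : R :=
  \prod_(u : 'I_T) smoothed_grad eta (gbpa_Ghat eta g f u) (f u).

Definition regret_of (g : 'I_T -> 'I_N -> R) (f : {ffun 'I_T -> 'I_N}) : \bar R :=
  (\big[Order.max/-oo]_(i : 'I_N) (\sum_(u : 'I_T) (g u i - g u (f u)))%:E)%E.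

Definition gbpa_expected_regret (eta : R) (g : 'I_T -> 'I_N -> R) : \bar R :=
  (\sum_(f : {ffun 'I_T -> 'I_N}) (gbpa_prob eta g f)%:E * regret_of g f)%E.

End bandit.

(* Main.v *)
Require Import Defs.
From HB Require Import structures.
From mathcomp Require Import all_boot all_order all_algebra.
From mathcomp Require Import all_classical all_reals all_analysis.
From mathcomp Require Import measurable_realfun ring lra.
Import Order.TTheory GRing.Theory Num.Theory.
Local Open Scope ring_scope.
Set Implicit Arguments.
Unset Strict Implicit.
Unset Printing Implicit Defensive.

(* The regret is controlled by the potential [E max_j (G_j + eta Z_j)].  Its
   subgradient inequality, taken at the new point, bounds the cost of a step
   that lowers arm i by a / p_i (a <= 1 its loss, p_i its probability) by
   a (p_i(G) - p_i(G - (a / p_i) e_i)).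
   By translation invariance of Lebesgue measure, with d the shift divided by
   eta, this drop is the mean of a function with values in [0, 1] against
   phi(z) - phi(z + d); since (z - t)^+ phi(z) <= exp(- t^2 / 2) phi(z - t) for
   t >= 1, it is at most d ((t + 1) p_i + exp(- t^2 / 2)).  Arms with
   p_i <= exp(- t^2 / 2) cost at most p_i, every other arm at most (t + 2) / eta,
   and exp(- t^2 / 2) = 1 / (N T) is a suitable level.  The same tail estimate
   bounds the initial potential by 2 eta sqrt(2 ln N).

   All partial integrals that occur are monotone or Lipschitz in each variable,
   hence measurable, so iterated integrals are handled without Fubini. *)

(** * Density, translations and tails of the standard normal law *)

Section gaussian.
Local Open Scope classical_set_scope.
Context {R : realType}.
Local Notation mu := (@lebesgue_measure R).
Local Notation nu := (normal_prob (0 : R) 1).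
Local Notation pdf := (normal_pdf (0 : R) 1).

Lemma std_pdfE (x : R) : pdf x = normal_peak (1 : R) * expR (- (x ^+ 2) / 2).
Proof.
rewrite normal_pdfE ?oner_eq0// /normal_fun subr0 expr1n.
by congr (_ * expR (_ / _)).
Qed.

Lemma std_pdfD (x d : R) :
  pdf (x + d) = pdf x * expR (- (x * d + d ^+ 2 / 2)).
Proof. by rewrite !std_pdfE -mulrA -expRD; congr (_ * expR _); lra. Qed.

Lemma std_pdfN (x : R) : pdf (- x) = pdf x.
Proof. by rewrite !std_pdfE sqrrN. Qed.

Let mpdf : measurable_fun [set: R] (fun x => (pdf x)%:E).
Proof. by apply/measurable_EFinP; exact: measurable_normal_pdf. Qed.

(** The Radon-Nikodym derivative of [nu] and [pdf] have equal integrals over every measurable set,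
    hence agree almost everywhere. *)
Lemma std_normal_density (f : R -> \bar R) :
  measurable_fun [set: R] f -> (forall x, 0 <= f x)%E ->
  (\int[nu]_x f x = \int[mu]_x (f x * (pdf x)%:E))%E.
Proof.
move=> mf f0; have dom := @normal_prob_dominates R 0 1.
rewrite -(Radon_Nikodym_SigmaFinite.change_of_variables dom)//=.
have RNi := Radon_Nikodym_SigmaFinite.f_integrable dom.
apply: ae_eq_integral => //.
- by apply: emeasurable_funM => //; exact: measurable_int RNi.
- exact: emeasurable_funM.
- apply: ae_eqe_mul2l; apply: integral_ae_eq => //.
  by move=> E _ mE; rewrite -Radon_Nikodym_SigmaFinite.f_integral.
Qed.


(** The pushforward of [mu] under a translation gives every interval its length, so it is [mu] by
    uniqueness. *)
Lemma ge0_integralD_shift (d : R) (f : R -> \bar R) :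
  measurable_fun [set: R] f -> (forall x, 0 <= f x)%E ->
  (\int[mu]_x f (x + d)%R = \int[mu]_x f x)%E.
Proof.
move=> mf f0.
have mD : measurable_fun [set: measurableTypeR R] ((fun x => x + d) : measurableTypeR R -> measurableTypeR R).
  exact: measurable_funD.
pose phi : {mfun (measurableTypeR R) >-> (measurableTypeR R)} :=
  HB.pack ((fun x => x + d) : _ -> measurableTypeR R)
    (isMeasurableFun.Build _ _ _ _ _ mD).
have muE (A : set R) : measurable A -> pushforward mu phi A = mu A.
  move=> mA; apply/esym/lebesgue_measure_unique => //= _ [[a b]] _ <-.
  rewrite /pushforward/= (_ : _ @^-1` _ = `]a - d, b - d]%classic); last first.
    by apply/seteqP; split => x /=; rewrite !in_itv/= ltrBlDr lerBrDr.
  rewrite !lebesgue_measure_itv/= !lte_fin ltrD2r.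
  by case: ifP => // _; rewrite -!EFinB; congr EFin; lra.
rewrite -[LHS]/(\int[mu]_(x in phi @^-1` setT) (f \o phi) x)%E.
rewrite -ge0_integral_pushforward//; apply: eq_measure_integral => A mA _.
exact: muE.
Qed.

Lemma ge0_integralN (f : R -> \bar R) :
  measurable_fun [set: R] f -> (forall x, 0 <= f x)%E ->
  (\int[mu]_x f (- x)%R = \int[mu]_x f x)%E.
Proof.
move=> mf f0.
rewrite -[LHS]/(\int[mu]_(x in (-%R : _ -> measurableTypeR R) @^-1` setT)
  (f \o (-%R : _ -> measurableTypeR R)) x)%E.
rewrite -ge0_integral_pushforward//; apply: eq_measure_integral => A mA _.
exact: lebesgue_measureN.
Qed.

Lemma integral_std_pdfD (d : R) : (\int[mu]_x (pdf (x + d))%:E = 1)%E.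
Proof.
rewrite (ge0_integralD_shift d mpdf) ?integral_normal_pdf// => x.
by rewrite lee_fin normal_pdf_ge0.
Qed.

Let mpdfD d : measurable_fun [set: R] (fun x => (pdf (x + d))%:E).
Proof.
apply/measurable_EFinP; apply: measurableT_comp.
  exact: measurable_normal_pdf.
exact: measurable_funD.
Qed.

(** Moving the shift from the integrand to the density lets shifted and unshifted means be compared
    pointwise, with no regularity of [f] beyond measurability. *)
Lemma std_normal_shift (d : R) (f : R -> R) :
  measurable_fun [set: R] f -> (forall x, 0 <= f x) ->
  (\int[nu]_x (f (x - d))%:E = \int[mu]_x (f x * pdf (x + d))%:E)%E.
Proof.
move=> mf f0.
have mfd : measurable_fun [set: R] (fun x => f (x - d)).
  apply: measurableT_comp => //; exact: measurable_funB.
rewrite std_normal_density//; last by move=> x; rewrite lee_fin.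
  rewrite -(@ge0_integralD_shift d (fun x => (f (x - d))%:E * (pdf x)%:E)%E).
  - by apply: eq_integral => x _; rewrite addrK.
  - by apply: emeasurable_funM => //; exact/measurable_EFinP.
  - by move=> x; rewrite -EFinM lee_fin mulr_ge0// normal_pdf_ge0.
exact/measurable_EFinP.
Qed.

Let mM (f g : R -> R) : measurable_fun [set: R] f -> measurable_fun [set: R] g ->
  measurable_fun [set: R] (fun x => (f x * g x)%:E).
Proof. by move=> mf mg; apply/measurable_EFinP; exact: measurable_funM. Qed.

Let mpdfR : measurable_fun [set: R] pdf.
Proof. exact: measurable_normal_pdf. Qed.

Let mpdfDR d : measurable_fun [set: R] (fun x => pdf (x + d)).
Proof. by apply/measurable_EFinP; exact: mpdfD. Qed.

(* Gaussian tilting: [pdf z * exp (t (z - t)) = exp (- t^2 / 2) * pdf (z - t)] *)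
Lemma std_pdf_excess (t z : R) : 1 <= t ->
  pdf z * Num.max 0 (z - t) <= expR (- t ^+ 2 / 2) * pdf (z - t).
Proof.
move=> t1; rewrite (std_pdfD z (- t)) mulrCA -expRD.
rewrite ler_wpM2l ?normal_pdf_ge0// ge_max expR_ge0/=.
have [zt|tz] := leP z t; first by rewrite (le_trans _ (expR_ge0 _))// subr_le0.
apply: (@le_trans _ _ (expR (z - t))).
  by rewrite (le_trans _ (expR_ge1Dx _))// lerDr.
rewrite ler_expR; nra.
Qed.

Lemma std_normal_excess (t : R) : 1 <= t ->
  (\int[nu]_z (Num.max 0 (z - t))%:E <= (expR (- t ^+ 2 / 2))%:E)%E.
Proof.
move=> t1.
have mm : measurable_fun [set: R] (fun z : R => Num.max 0 (z - t)).
  by apply: measurable_maxr => //; exact: measurable_funB.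
rewrite std_normal_density; [|exact/measurable_EFinP|]; last first.
  by move=> x; rewrite lee_fin le_max lexx.
rewrite -[leRHS]mule1 -(integral_std_pdfD (- t)).
rewrite -ge0_integralZl; [|done|exact: mpdfD| |]; last 2 first.
- by move=> x _; rewrite lee_fin normal_pdf_ge0.
- by rewrite lee_fin expR_ge0.
apply: ge0_le_integral => //=.
- by move=> x _; rewrite -EFinM lee_fin mulr_ge0 ?normal_pdf_ge0// le_max lexx.
- by apply: (mM mm).
- by apply: (mM (measurable_cst _) (mpdfDR _)).
- move=> x _; rewrite -!EFinM lee_fin mulrC; exact: std_pdf_excess.
Qed.

(** Pointwise, [f x * (pdf x - pdf (x + d))] is at most [d * (x + d / 2) * f x * pdf x]. For
    [d <= 1] the factor [x + d / 2] is at most [t + 1 + Num.max 0 (x - t)]; the excess over [t] is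
    paid for by tilting, with [f x <= 1]. *)
Lemma std_normal_shift_le (t d : R) (f : R -> R) : 1 <= t -> 0 <= d ->
  measurable_fun [set: R] f -> (forall x, 0 <= f x <= 1) ->
  (\int[nu]_x (f x)%:E <= \int[nu]_x (f (x - d))%:E +
     (d * (t + 1))%:E * \int[nu]_x (f x)%:E + (d * expR (- t ^+ 2 / 2))%:E)%E.
Proof.
move=> t1 d0 mf f01; have f0 x : 0 <= f x by case/andP: (f01 x).
have f1 x : f x <= 1 by case/andP: (f01 x).
rewrite std_normal_shift// std_normal_density;
  [|exact/measurable_EFinP|by move=> x; rewrite lee_fin].
(* The last term is multiplied by the total mass of [pdf (x - t)], so that the claim becomes a
   pointwise inequality under one integral. *)
rewrite -[X in (_ <= _ + X)%E]mule1 -(integral_std_pdfD (- t)).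
have p0 x : 0 <= pdf x by exact: normal_pdf_ge0.
have dt0 : 0 <= d * (t + 1) by rewrite mulr_ge0// addr_ge0// (le_trans _ t1).
have de0 : 0 <= d * expR (- t ^+ 2 / 2) by rewrite mulr_ge0// expR_ge0.
have mfp := mM mf mpdfR.
rewrite -ge0_integralZl//=; last first.
  by move=> x _; rewrite mule_ge0// lee_fin.
rewrite -ge0_integralZl; [|done|exact: mpdfD| |by rewrite lee_fin]; last first.
  by move=> x _; rewrite lee_fin.
have m1 := mM mf (mpdfDR d).
have m2 : measurable_fun [set: R] (fun x => ((d * (t + 1))%:E * ((f x)%:E * (pdf x)%:E))%E).
  by apply: (mM (measurable_cst _)); exact: measurable_funM.
have m3 : measurable_fun [set: R] (fun x => ((d * expR (- t ^+ 2 / 2))%:E * (pdf (x - t))%:E)%E).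
  by apply: (mM (measurable_cst _)).
rewrite -ge0_integralD//; last 2 first.
- by move=> x _; rewrite lee_fin mulr_ge0.
- by move=> x _; rewrite !mule_ge0// ?lee_fin.
rewrite -ge0_integralD//; last 3 first.
- by move=> x _; rewrite adde_ge0// ?mule_ge0// ?lee_fin// mulr_ge0.
- exact: emeasurable_funD.
- by move=> x _; rewrite !mule_ge0// ?lee_fin.
apply: ge0_le_integral => //=.
- by move=> x _; rewrite mule_ge0// lee_fin.
- by apply: emeasurable_funD => //; exact: emeasurable_funD.
move=> x _; rewrite -!EFinM -!EFinD lee_fin.
(* For [d > 1] the middle term suffices, because [d * (t + 1) >= 1]. *)
have [d1|d1] := leP d 1; last first.
  rewrite (@le_trans _ _ (d * (t + 1) * (f x * pdf x)))//.
    by rewrite ler_peMl ?mulr_ge0//; nra.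
  by rewrite addrAC ler_wpDl// addr_ge0// mulr_ge0.
have h1 := std_pdf_excess x t1.
rewrite -[X in _ <= _ + X]mulrA.
apply: (@le_trans _ _ (f x * pdf (x + d) + d * (t + 1) * (f x * pdf x) +
   d * (pdf x * Num.max 0 (x - t)))); last by rewrite lerD2l ler_wpM2l.
rewrite std_pdfD.
set E := expR _.
have hE : 1 - E <= x * d + d ^+ 2 / 2.
  by have := expR_ge1Dx (- (x * d + d ^+ 2 / 2)); rewrite -/E; lra.
have m0 : 0 <= Num.max 0 (x - t) by rewrite le_max lexx.
have mxt : x - t <= Num.max 0 (x - t) by rewrite le_max lexx orbT.
have fm : f x * (1 - E) <= f x * (d * (t + 1)) + d * Num.max 0 (x - t).
  apply: (@le_trans _ _ (f x * (d * (t + 1 + Num.max 0 (x - t))))).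
    rewrite ler_wpM2l//; nra.
  rewrite mulrDr mulrDr lerD2l mulrC -[leRHS]mulr1.
  by rewrite ler_wpM2l// mulr_ge0.
have := ler_wpM2l (p0 x) fm; set m := Num.max _ _; nra.
Qed.

(** The bound [|x| <= expR x + expR (- x)] suffices: each exponential times [pdf] is [expR (1 / 2)]
    times a density translated by 1 or -1. *)
Lemma std_normal_integrable_id : nu.-integrable setT (fun x : R => x%:E).
Proof.
apply/integrableP; split; first exact/measurable_EFinP.
have mn : measurable_fun [set: R] (fun z : R => `|z|) by exact: normr_measurable.
rewrite std_normal_density//=; last exact/measurable_EFinP.
have e2 : 0 <= expR (2^-1 : R) by exact: expR_ge0.
pose g (d x : R) : \bar R := ((expR (2^-1 : R))%:E * (pdf (x + d))%:E)%E.
have mg d : measurable_fun [set: R] (g d).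
  exact: (mM (measurable_cst _) (mpdfDR _)).
have g0 d x : (0 <= g d x)%E by rewrite mule_ge0// lee_fin// normal_pdf_ge0.
apply: (@le_lt_trans _ _ (\int[mu]_x (g (-1)%R x + g 1%R x)%E)%E).
  apply: ge0_le_integral => //=.
  - by move=> x _; rewrite mule_ge0// lee_fin normal_pdf_ge0.
  - exact: (mM mn).
  - exact: (emeasurable_funD (mg _) (mg _)).
  move=> x _; rewrite /g -!EFinM -EFinD lee_fin !std_pdfD.
  rewrite [X in _ <= X](_ : _ = (expR x + expR (- x)) * pdf x); last first.
    rewrite mulrCA -expRD mulrCA -expRD -mulrDr mulrC; congr ((expR _ + expR _) * _); lra.
  rewrite ler_wpM2r ?normal_pdf_ge0//.
  have := expR_ge1Dx x; have := expR_ge1Dx (- x).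
  have := expR_ge0 x; have := expR_ge0 (- x).
  by have [x0|x0] := ger0P x; lra.
have gE d : (\int[mu]_x g d x = (expR (2^-1 : R))%:E)%E.
  rewrite ge0_integralZl; [|done|exact: mpdfD| |by rewrite lee_fin].
    by rewrite integral_std_pdfD mule1.
  by move=> x _; rewrite lee_fin normal_pdf_ge0.
rewrite ge0_integralD//; [|exact: mg|exact: mg].
by rewrite !gE -EFinD ltry.
Qed.

(** By symmetry of [pdf] the positive and negative parts have the same integral, which is finite. *)
Lemma std_normal_mean : (\int[nu]_x (x%:E : \bar R) = 0)%E.
Proof.
have ix := std_normal_integrable_id.
have nuN (f : R -> R) : measurable_fun [set: R] f -> (forall x, 0 <= f x) ->
    (\int[nu]_x (f (- x))%:E = \int[nu]_x (f x)%:E)%E.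
  move=> mf f0.
  have mfN : measurable_fun [set: R] (fun x => f (- x)) by exact: measurableT_comp.
  rewrite std_normal_density;
    [|exact/measurable_EFinP|by move=> x; rewrite lee_fin].
  rewrite std_normal_density;
    [|exact/measurable_EFinP|by move=> x; rewrite lee_fin].
  rewrite -(@ge0_integralN (fun x => (f x)%:E * (pdf x)%:E)%E).
  - by apply: eq_integral => x _; rewrite std_pdfN.
  - exact: (mM mf).
  - by move=> x; rewrite mule_ge0// lee_fin// normal_pdf_ge0.
rewrite integralE.
have -> : (\int[nu]_x (fun x => x%:E)^\- x = \int[nu]_x (fun x => x%:E)^\+ x)%E.
  rewrite [RHS](_ : _ = \int[nu]_x (Num.max x 0)%:E)%E; last first.
    by apply: eq_integral => x _; rewrite funeposE -EFin_max.
  rewrite -nuN.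
  - by apply: eq_integral => x _; rewrite funenegE -EFin_max.
  - exact: measurable_maxr.
  - by move=> x; rewrite le_max lexx orbT.
by rewrite subee//; apply: integrable_pos_fin_num.
Qed.

End gaussian.

(** * Iterated Gaussian means, their integrability and their behaviour under a shift *)

Section gaussian_expectation.
Local Open Scope classical_set_scope.
Context {R : realType}.
Local Notation nu := (normal_prob (0 : R) 1).

Let intD (f g : R -> R) : nu.-integrable setT (EFin \o f) ->
  nu.-integrable setT (EFin \o g) ->
  nu.-integrable setT (EFin \o (fun x => f x + g x)).
Proof. by move=> fi gi; exact: (integrableD measurableT fi gi). Qed.

Let intZ (c : R) (f : R -> R) : nu.-integrable setT (EFin \o f) ->
  nu.-integrable setT (EFin \o (fun x => c * f x)).
Proof. by move=> fi; exact: (integrableZl measurableT c fi). Qed.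

(** Real-valued counterpart of [gauss_expect], on which linearity and subtraction are available;
    [gauss_expectE] links the two. *)
Fixpoint gauss_mean (n : nat) (h : seq R -> R) : R :=
  match n with
  | 0 => h [::]
  | n'.+1 => \int[nu]_z gauss_mean n' (fun w => h (z :: w))
  end.

(* Integrability of all the partial integrals; it replaces joint measurability. *)
Fixpoint gauss_integrable (n : nat) (h : seq R -> R) : Prop :=
  match n with
  | 0 => True
  | n'.+1 => (forall z, gauss_integrable n' (fun w => h (z :: w))) /\
      nu.-integrable setT (EFin \o (fun z => gauss_mean n' (fun w => h (z :: w))))
  end.

Lemma gauss_expectE n h : gauss_integrable n h ->
  gauss_expect n (fun w => (h w)%:E) = (gauss_mean n h)%:E.
Proof.
elim: n h => [//|n IH] h /= [hz hi].
under eq_integral do rewrite IH//.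
by rewrite /Rintegral fineK//; exact: (integrable_fin_num measurableT hi).
Qed.

Lemma le_gauss_mean n h h' : gauss_integrable n h -> gauss_integrable n h' ->
  (forall w, h w <= h' w) -> gauss_mean n h <= gauss_mean n h'.
Proof.
elim: n h h' => [|n IH] h h' /=; first by move=> _ _; exact.
move=> [hz hi] [hz' hi'] hh'.
by apply: le_Rintegral => // z _; exact: IH.
Qed.

Lemma gauss_integrable_cst n c : gauss_integrable n (fun=> c)
  /\ gauss_mean n (fun=> c) = c.
Proof.
elim: n => [//|n [IH IH']] /=; rewrite IH'; split.
  by split => //; exact: finite_measure_integrable_cst.
by rewrite Rintegral_cst// [X in fine X]probability_setT mulr1.
Qed.

Lemma gauss_meanD n h h' : gauss_integrable n h -> gauss_integrable n h' ->
  gauss_integrable n (fun w => h w + h' w)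
  /\ gauss_mean n (fun w => h w + h' w) = gauss_mean n h + gauss_mean n h'.
Proof.
elim: n h h' => [//|n IH] h h' /= [hz hi] [hz' hi'].
have E : (fun z => gauss_mean n (fun w => h (z :: w) + h' (z :: w))) =
  (fun z => gauss_mean n (fun w => h (z :: w)) + gauss_mean n (fun w => h' (z :: w))).
  by apply/funext => z; have [_ ->] := IH _ _ (hz z) (hz' z).
rewrite E RintegralD//; split => //; split; last exact: intD.
by move=> z; have [] := IH _ _ (hz z) (hz' z).
Qed.

Lemma gauss_meanZ n c h : gauss_integrable n h ->
  gauss_integrable n (fun w => c * h w)
  /\ gauss_mean n (fun w => c * h w) = c * gauss_mean n h.
Proof.
elim: n h => [//|n IH] h /= [hz hi].
have E : (fun z => gauss_mean n (fun w => c * h (z :: w))) =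
  (fun z => c * gauss_mean n (fun w => h (z :: w))).
  by apply/funext => z; have [_ ->] := IH _ (hz z).
rewrite E RintegralZl//; split => //; split; last exact: intZ.
by move=> z; have [] := IH _ (hz z).
Qed.

Lemma gauss_mean_sum n (I : Type) (r : seq I) (h : I -> seq R -> R) :
  (forall i, gauss_integrable n (h i)) ->
  gauss_integrable n (fun w => \sum_(i <- r) h i w)
  /\ gauss_mean n (fun w => \sum_(i <- r) h i w) = \sum_(i <- r) gauss_mean n (h i).
Proof.
move=> hi; elim: r => [|i r [IH IH']].
  have -> : (fun w => \sum_(i <- [::]) h i w) = (fun=> 0).
    by apply/funext => w; rewrite big_nil.
  by rewrite big_nil; exact: gauss_integrable_cst.
have -> : (fun w => \sum_(i <- i :: r) h i w) =
          (fun w => h i w + \sum_(i <- r) h i w).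
  by apply/funext => w; rewrite big_cons.
by rewrite big_cons -IH'; apply: gauss_meanD.
Qed.

Lemma gauss_mean_coord n (j : nat) (f : R -> R) : (j < n)%N ->
  nu.-integrable setT (EFin \o f) ->
  gauss_integrable n (fun w => f (nth 0 w j))
  /\ gauss_mean n (fun w => f (nth 0 w j)) = \int[nu]_z f z.
Proof.
move=> jn fi; elim: n j jn => [//|n IH] [|j] jn /=.
  have E : (fun z => gauss_mean n (fun _ => f z)) = f.
    by apply/funext => z; have [] := gauss_integrable_cst n (f z).
  rewrite E; split => //; split => // z.
  by have [] := gauss_integrable_cst n (f z).
have [hi ->] := IH j jn; split.
  by split => //; exact: finite_measure_integrable_cst.
by rewrite Rintegral_cst// [X in fine X]probability_setT mulr1.
Qed.

(** A partial mean [F] inherits the constant [C]. It is measurable because [F z + C * z] is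
    nondecreasing, and integrable because it is dominated by [|F 0| + C * |z|]. *)
Lemma gauss_integrable_lipschitz n (C : R) h : 0 <= C ->
  (forall u z z' w, `|h (u ++ z :: w) - h (u ++ z' :: w)| <= C * `|z - z'|) ->
  gauss_integrable n h.
Proof.
move=> C0; elim: n h => [//|n IH] h hC /=.
have hz z : gauss_integrable n (fun w => h (z :: w)).
  by apply: IH => u z1 z2 w; exact: (hC (z :: u)).
split => //; set F := fun z => _.
have FC z z' : F z <= F z' + C * `|z - z'|.
  have [ci cE] := gauss_integrable_cst n (C * `|z - z'|).
  have [ai aE] := gauss_meanD (hz z') ci.
  rewrite -cE -aE; apply: le_gauss_mean => // w.
  by have := hC [::] z z' w; rewrite ler_norml => /andP[_]; rewrite lerBlDl.
have mF : measurable_fun [set: R] F.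
  have -> : F = (fun z => (F z + C * z) - C * z) by apply/funext => z; rewrite addrK.
  apply: measurable_funB; last exact: measurable_funM.
  apply: nondecreasing_measurable => // x y xy.
  by have := FC x y; rewrite ler0_norm ?subr_le0//; lra.
apply: (@le_integrable _ _ _ nu setT measurableT _ (EFin \o (fun z : R => `|F 0| + C * `|z|))) => //.
- exact/measurable_EFinP.
- move=> z _ /=; rewrite lee_fin [leRHS]ger0_norm ?addr_ge0 ?mulr_ge0//.
  have := FC z 0; have := FC 0 z; rewrite sub0r normrN subr0.
  have := ler_norm (F 0); have := ler_norm (- F 0); rewrite normrN.
  by rewrite ler_norml; lra.
- apply: intD; first exact: finite_measure_integrable_cst.
  apply: intZ; exact: (integrable_abse std_normal_integrable_id).
Qed.

(** The direction may depend on the prefix [u] but not on the remaining entries [w], so it survives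
    integration over [w]. *)
Definition coordinatewise_monotone (h : seq R -> R) := forall u,
  (forall z z' w, z <= z' -> h (u ++ z :: w) <= h (u ++ z' :: w)) \/
  (forall z z' w, z <= z' -> h (u ++ z' :: w) <= h (u ++ z :: w)).

Lemma coordinatewise_monotone_cons h z : coordinatewise_monotone h ->
  coordinatewise_monotone (fun w => h (z :: w)).
Proof. by move=> hm u; exact: (hm (z :: u)). Qed.

Let measurable_of_monotone n h : coordinatewise_monotone h ->
  (forall z, gauss_integrable n (fun w => h (z :: w))) ->
  measurable_fun [set: R] (fun z => gauss_mean n (fun w => h (z :: w))).
Proof.
move=> hm hz; case: (hm [::]) => hm0.
  by apply: nondecreasing_measurable => // x y xy; apply: le_gauss_mean => // w; exact: hm0.
by apply: nonincreasing_measurable => // x y xy; apply: le_gauss_mean => // w; exact: hm0.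
Qed.

Lemma gauss_mean_bound n h : gauss_integrable n h -> (forall w, 0 <= h w <= 1) ->
  0 <= gauss_mean n h <= 1.
Proof.
move=> hi h01; have [i0 E0] := gauss_integrable_cst n 0.
have [i1 E1] := gauss_integrable_cst n 1.
by apply/andP; split; [rewrite -[leLHS]E0|rewrite -[leRHS]E1];
  apply: le_gauss_mean => // w; case/andP: (h01 w).
Qed.

Lemma gauss_integrable_monotone n h : coordinatewise_monotone h ->
  (forall w, 0 <= h w <= 1) -> gauss_integrable n h.
Proof.
elim: n h => [//|n IH] h hm h01 /=.
have hz z : gauss_integrable n (fun w => h (z :: w)).
  by apply: IH => //; exact: coordinatewise_monotone_cons.
split => //; apply: (@le_integrable _ _ _ nu setT measurableT _ (EFin \o cst (1 : R))) => //.
- by apply/measurable_EFinP; exact: measurable_of_monotone.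
- move=> z _ /=; rewrite lee_fin normr1.
  by have /andP[a b] := gauss_mean_bound (hz z) (fun w => h01 (z :: w)); rewrite ger0_norm.
- exact: finite_measure_integrable_cst.
Qed.

(** At coordinate [i] the one-dimensional estimate applies to the mean over the later coordinates.
    The resulting inequality is linear in both means, so it can be integrated over the earlier
    coordinates. *)
Lemma gauss_mean_shift n (i : nat) (t d : R) h h' : (i < n)%N -> 1 <= t -> 0 <= d ->
  coordinatewise_monotone h -> coordinatewise_monotone h' ->
  (forall w, 0 <= h w <= 1) -> (forall w, 0 <= h' w <= 1) ->
  (forall u z w, size u = i -> h' (u ++ z :: w) = h (u ++ (z - d) :: w)) ->
  gauss_mean n h <= gauss_mean n h' +
    d * ((t + 1) * gauss_mean n h + expR (- t ^+ 2 / 2)).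
Proof.
move=> + t1 d0; elim: n i h h' => [//|n IH] i h h' + hm hm' h01 h01' hh'.
have [hz hi] : gauss_integrable n.+1 h by exact: gauss_integrable_monotone.
have [hz' hi'] : gauss_integrable n.+1 h' by exact: gauss_integrable_monotone.
case: i hh' => [|i] hh' lt_in.
  rewrite /=; set F := (fun z => gauss_mean n (fun w => h (z :: w))).
  have F01 z : 0 <= F z <= 1 by exact: (gauss_mean_bound (hz z) (fun w => h01 (z :: w))).
  have E : (fun z => gauss_mean n (fun w => h' (z :: w))) = (fun z => F (z - d)).
    by apply/funext => z; congr gauss_mean; apply/funext => w; exact: (hh' [::]).
  have mF : measurable_fun [set: R] F by exact: (measurable_of_monotone hm hz).
  have := std_normal_shift_le t1 d0 mF F01.
  move: hi'; rewrite /= E => hi'.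
  have f1 := integrable_fin_num measurableT hi.
  have f2 := integrable_fin_num measurableT hi'.
  rewrite -[X in (X <= _)%E]fineK// -[X in (_ <= X + _ + _)%E]fineK//.
  rewrite -[X in (_ <= _ + _ * X + _)%E]fineK// -EFinM -!EFinD lee_fin.
  by move=> /le_trans; apply; rewrite /Rintegral [in leRHS]mulrDr !mulrA addrA.
rewrite /=; set F := (fun z => gauss_mean n (fun w => h (z :: w))).
set F' := (fun z => gauss_mean n (fun w => h' (z :: w))).
set e := expR _.
have -> : \int[nu]_z F' z + d * ((t + 1) * \int[nu]_z F z + e) =
    \int[nu]_z (F' z + (d * (t + 1) * F z + d * e)).
  have iZ : nu.-integrable setT (EFin \o (fun z => d * (t + 1) * F z)).
    exact: intZ.
  have ic : nu.-integrable setT (EFin \o (fun z : R => d * e)).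
    exact: finite_measure_integrable_cst.
  rewrite RintegralD//; last exact: intD.
  rewrite RintegralD// RintegralZl// Rintegral_cst// [X in fine X]probability_setT.
  by rewrite mulr1; lra.
apply: le_Rintegral => //.
  apply: intD => //; apply: intD => //; first exact: intZ.
  exact: finite_measure_integrable_cst.
move=> z _; rewrite -mulrA -mulrDr.
apply: (IH i) => //; try exact: coordinatewise_monotone_cons.
by move=> u z1 w su; apply: (hh' (z :: u)); rewrite /= su.
Qed.

End gaussian_expectation.

(** * The perturbed leader: choice probabilities and the smoothed potential *)

Section perturbed_leader.
Context {R : realType}.
Variables (N : nat) (eta : R).
Hypothesis eta_gt0 : 0 < eta.
Implicit Types (G : 'I_N -> R) (i j k : 'I_N) (w u : seq R).
Local Notation nu := (normal_prob (0 : R) 1).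

Definition leads G i w : R :=
  if [forall j : 'I_N, (j != i) ==>
        (G j + eta * nth 0 w j < G i + eta * nth 0 w i)] then 1 else 0.

Definition bump_arm G i (s : R) : 'I_N -> R :=
  fun j => G j + (if i == j then s else 0).

Lemma bump_armK G i s : bump_arm (bump_arm G i s) i (- s) = G.
Proof.
by apply/funext => j; rewrite /bump_arm; case: ifP; rewrite ?addr0// addrK.
Qed.

Lemma leads_bound G i w : 0 <= leads G i w <= 1.
Proof. by rewrite /leads; case: ifP; rewrite lexx ler01. Qed.

Lemma leadsP G i w : reflect (forall j, j != i ->
    G j + eta * nth 0 w j < G i + eta * nth 0 w i) (leads G i w == 1).
Proof.
rewrite /leads; case: ifP => h.
  by rewrite eqxx; constructor => j; move/forallP/(_ j)/implyP: h.
rewrite eq_sym oner_eq0; constructor => h'; move/negP: h; apply.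
by apply/forallP => j; apply/implyP; exact: h'.
Qed.

Lemma leads_eq0 G i w : leads G i w != 1 -> leads G i w = 0.
Proof. by rewrite /leads; case: ifP; rewrite ?eqxx. Qed.

Lemma le_leads G G' i w w' :
  (forall j, j != i -> G j + eta * nth 0 w j < G i + eta * nth 0 w i ->
     G' j + eta * nth 0 w' j < G' i + eta * nth 0 w' i) ->
  leads G i w <= leads G' i w'.
Proof.
move=> h; have [/leadsP h1|/leads_eq0 ->] := boolP (leads G i w == 1); last first.
  by case/andP: (leads_bound G' i w').
have /leadsP/eqP-> : forall j, j != i ->
    G' j + eta * nth 0 w' j < G' i + eta * nth 0 w' i.
  by move=> j ji; apply: h => //; exact: h1.
by case/andP: (leads_bound G i w).
Qed.

Let nth_insert (u : seq R) (z : R) (w : seq R) (j : nat) :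
  nth 0 (u ++ z :: w) j = if j == size u then z else nth 0 (u ++ 0 :: w) j.
Proof.
rewrite !nth_cat; case: (ltngtP j (size u)) => //= [lt|->]; last by rewrite subnn.
by rewrite -(prednK (n := (j - size u)%N))// subn_gt0.
Qed.

(** Raising the noise of arm [i] favours it; raising any other entry of the sample can only hurt
    it. *)
Lemma leads_monotone G i : coordinatewise_monotone (leads G i).
Proof.
move=> u; have [iu|iu] := eqVneq (val i) (size u); [left|right] => z z' w zz';
  apply: le_leads => j ji;
  rewrite !(nth_insert u z w) !(nth_insert u z' w) ?iu ?(negbTE iu) ?eqxx.
  have -> : (val j == size u) = false by rewrite -iu (inj_eq val_inj) (negbTE ji).
  by move=> /lt_le_trans; apply; rewrite lerD2l ler_wpM2l// ltW.
case: ifP => // _ /(le_lt_trans _); apply.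
by rewrite lerD2l ler_wpM2l// ltW.
Qed.

Lemma leads_integrable G i : gauss_integrable N (leads G i).
Proof.
by apply: gauss_integrable_monotone; [exact: leads_monotone|exact: leads_bound].
Qed.

Lemma smoothed_gradE G i : smoothed_grad eta G i = gauss_mean N (leads G i).
Proof. by rewrite /smoothed_grad (gauss_expectE (leads_integrable G i)). Qed.

Lemma smoothed_grad_bound G i : 0 <= smoothed_grad eta G i <= 1.
Proof.
rewrite smoothed_gradE; apply: gauss_mean_bound => //; last exact: leads_bound.
exact: leads_integrable.
Qed.

Lemma smoothed_grad_ge0 G i : 0 <= smoothed_grad eta G i.
Proof. by case/andP: (smoothed_grad_bound G i). Qed.

(** Lowering [G i] by [s] has the same effect as lowering the [i]-th noise variable by [s / eta]. *)
Lemma smoothed_grad_shift G i (t s : R) : 1 <= t -> 0 <= s ->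
  smoothed_grad eta G i <= smoothed_grad eta (bump_arm G i (- s)) i +
    s / eta * ((t + 1) * smoothed_grad eta G i + expR (- t ^+ 2 / 2)).
Proof.
move=> t1 s0; rewrite !smoothed_gradE; apply: (@gauss_mean_shift _ _ i) => //.
- by rewrite divr_ge0// ltW.
- exact: leads_monotone.
- exact: leads_monotone.
- exact: leads_bound.
- exact: leads_bound.
move=> u z w su.
have E j : j != i -> (bump_arm G i (- s) j + eta * nth 0 (u ++ z :: w) j <
      bump_arm G i (- s) i + eta * nth 0 (u ++ z :: w) i) =
    (G j + eta * nth 0 (u ++ (z - s / eta) :: w) j <
      G i + eta * nth 0 (u ++ (z - s / eta) :: w) i).
  move=> ji; rewrite !(nth_insert u z w) !(nth_insert u (z - s / eta) w) su eqxx /bump_arm eqxx eq_sym.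
  rewrite (negbTE ji) addr0 (inj_eq val_inj) (negbTE ji); congr (_ < _).
  by field; rewrite gt_eqF.
rewrite /leads; congr (if _ then _ else _).
apply: eq_forallb => j; case: (eqVneq j i) => //= ji; exact: E.
Qed.

Section potential.
Variable i0 : 'I_N.

(** The default of the maximum is the candidate of [i0], so the value is always attained by some
    arm. *)
Definition leader_value G w : R :=
  \big[Num.max/(G i0 + eta * nth 0 w i0)]_(j : 'I_N) (G j + eta * nth 0 w j).

Lemma le_leader_value G w j : G j + eta * nth 0 w j <= leader_value G w.
Proof. exact: (@le_bigmax _ _ _ _ (fun j => G j + eta * nth 0 w j)). Qed.

Lemma leader_value_le G w x :
  (forall j, G j + eta * nth 0 w j <= x) -> leader_value G w <= x.
Proof. by move=> h; apply: bigmax_le. Qed.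

Lemma leader_valueP G w : exists j, leader_value G w = G j + eta * nth 0 w j.
Proof.
rewrite /leader_value; apply: (big_ind (fun x => exists j, x = G j + eta * nth 0 w j))
  => [|x y [j ->] [k ->]|j _]; last by exists j.
- by exists i0.
- by rewrite maxEle; case: ifP; [exists k|exists j].
Qed.

Lemma leader_value_integrable G : gauss_integrable N (leader_value G).
Proof.
have lip u z z' w : leader_value G (u ++ z :: w) <=
    leader_value G (u ++ z' :: w) + eta * `|z - z'|.
  apply: leader_value_le => j.
  apply: (@le_trans _ _ (G j + eta * nth 0 (u ++ z' :: w) j + eta * `|z - z'|)).
    rewrite -addrA lerD2l -mulrDr ler_wpM2l ?(ltW eta_gt0)// (nth_insert u z w) (nth_insert u z' w).
    case: ifP => _; last by rewrite lerDl.
    by rewrite -lerBlDl ler_norm.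
  by rewrite lerD2r le_leader_value.
apply: (@gauss_integrable_lipschitz _ _ eta); first exact: ltW.
move=> u z z' w; rewrite ler_norml; have := lip u z z' w.
by have := lip u z' z w; rewrite (distrC z'); lra.
Qed.

Definition potential G : R := gauss_mean N (leader_value G).

Let int_id : nu.-integrable setT (EFin \o (id : R -> R)).
Proof. exact: std_normal_integrable_id. Qed.

(** The noise is centred, so [G k] is the mean of the [k]-th candidate, which lies below the
    maximum. *)
Lemma le_potential G k : G k <= potential G.
Proof.
have [ic cE] := gauss_integrable_cst N (G k).
have [iw wE] := gauss_mean_coord (ltn_ord k) int_id.
have [iz zE] := gauss_meanZ eta iw.
have [ia aE] := gauss_meanD ic iz.
have <- : gauss_mean N (fun w => G k + eta * nth 0 w k) = G k.
  by rewrite aE cE zE wE /Rintegral [X in fine X]std_normal_mean mulr0 addr0.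
apply: le_gauss_mean => // [|w]; first exact: leader_value_integrable.
exact: le_leader_value.
Qed.

(** The maximum of the noise is at most [t] plus the sum of all excesses over [t]. *)
Lemma potential0_le (t : R) : 1 <= t ->
  potential (fun=> 0) <= eta * (t + N%:R * expR (- t ^+ 2 / 2)).
Proof.
move=> t1; pose f (z : R) : R := Num.max 0 (z - t).
have f0 z : 0 <= f z by rewrite le_max lexx.
have fle := std_normal_excess t1.
have fi : nu.-integrable setT (EFin \o f).
  apply/integrableP; split.
    apply/measurable_EFinP; apply: measurable_maxr => //; exact: measurable_funB.
  under eq_integral do rewrite /= ger0_norm//.
  by rewrite (le_lt_trans fle)// ltry.
have hj (j : 'I_N) := gauss_mean_coord (ltn_ord j) fi.
have [is_ sE] := gauss_mean_sum (index_enum 'I_N) (fun j => (hj j).1).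
have [ic cE] := gauss_integrable_cst N t.
have [ia aE] := gauss_meanD ic is_.
have [iz zE] := gauss_meanZ eta ia.
apply: (@le_trans _ _ (gauss_mean N
    (fun w => eta * (t + \sum_(j : 'I_N) f (nth 0 w j))))).
  apply: le_gauss_mean => // [|w]; first exact: leader_value_integrable.
  apply: leader_value_le => j; rewrite add0r ler_wpM2l ?(ltW eta_gt0)//.
  rewrite (bigD1 j)//= addrA -[leLHS]addr0 lerD//; last first.
    by apply: sumr_ge0 => k _; exact: f0.
  by rewrite -lerBlDl le_max lexx orbT.
rewrite zE aE cE sE ler_wpM2l ?(ltW eta_gt0)// lerD2l.
under eq_bigr do rewrite (hj _).2.
rewrite sumr_const card_ord mulr_natl lerMn2r; apply/orP; right.
rewrite /Rintegral -lee_fin fineK//.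
exact: (integrable_fin_num measurableT fi).
Qed.

(* Subgradient inequality for the convex function [potential], taken at the
   new point so that only the gradient at [bump_arm G i s] appears. *)
Lemma potential_bump G i s : s <= 0 ->
  potential (bump_arm G i s) - potential G <=
  s * smoothed_grad eta (bump_arm G i s) i.
Proof.
move=> s0; rewrite lerBlDr -lerBlDl -mulNr smoothed_gradE.
have [iz zE] := gauss_meanZ (- s) (leads_integrable (bump_arm G i s) i).
have [ia aE] := gauss_meanD (leader_value_integrable (bump_arm G i s)) iz.
rewrite -zE; rewrite -[leLHS]aE.
apply: le_gauss_mean => // [|w]; first exact: leader_value_integrable.
have [/[dup] /leadsP h /eqP ->|/leads_eq0 ->] :=
    boolP (leads (bump_arm G i s) i w == 1).
  rewrite mulr1; apply: (le_trans _ (le_leader_value G w i)).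
  rewrite lerBlDr; apply: leader_value_le => j.
  rewrite [leRHS](_ : _ = bump_arm G i s i + eta * nth 0 w i); last first.
    by rewrite /bump_arm eqxx; lra.
  by have [->|/h/ltW] := eqVneq j i.
rewrite mulr0 addr0; apply: leader_value_le => j.
apply: (le_trans _ (le_leader_value G w j)); rewrite lerD2r /bump_arm.
by case: ifP => _; lra.
Qed.

(** At most one arm leads strictly, which gives one inequality. For the other, instead of a null-set
    argument for ties, each arm is raised slightly and [smoothed_grad_shift] bounds the change in
    its probability. *)
Lemma smoothed_grad_sum G : \sum_i smoothed_grad eta G i = 1.
Proof.
have [i1 E1] := gauss_integrable_cst N (1 : R).
apply/eqP; rewrite eq_le; apply/andP; split.
  under eq_bigr do rewrite smoothed_gradE.
  have [is_ sE] := gauss_mean_sum (index_enum 'I_N) (leads_integrable G).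
  rewrite -sE -[leRHS]E1; apply: le_gauss_mean => // w.
  have [[i /leadsP h]|h] := pselect (exists i, leads G i w == 1); last first.
    rewrite big1 ?ler01// => i _; apply: leads_eq0; apply/negP => hi.
    by apply: h; exists i.
  rewrite (bigD1 i)//= big1 ?addr0; first by case/andP: (leads_bound G i w).
  move=> j ji; apply: leads_eq0; apply/negP => /leadsP/(_ i); rewrite eq_sym.
  by move=> /(_ ji) /(lt_trans (h _ ji)); rewrite ltxx.
(* A maximiser for [G] leads strictly once its own entry is raised. *)
apply/ler_addgt0Pr => e e0.
(* At level [t = 1] the shift bound has the factor [2 * p + expR (- 1 / 2) <= 3], so raising by
   [e / c] costs [e] in total over the [N] arms. *)
pose c := N%:R * (3 / eta).
have N0 : 0 < N%:R :> R by rewrite ltr0n (leq_trans _ (ltn_ord i0)).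
have c0 : 0 < c by rewrite mulr_gt0// divr_gt0.
have ec0 : 0 < e / c by rewrite divr_gt0.
have [is_ sE] := gauss_mean_sum (index_enum 'I_N)
  (fun i => leads_integrable (bump_arm G i (e / c)) i).
apply: (@le_trans _ _ (\sum_i smoothed_grad eta (bump_arm G i (e / c)) i)).
  under eq_bigr do rewrite smoothed_gradE.
  rewrite -sE -[leLHS]E1; apply: le_gauss_mean => // w.
  have [i iE] := leader_valueP G w.
  rewrite (bigD1 i)//= (_ : leads _ i w = 1) ?lerDl.
    by apply: sumr_ge0 => j _; case/andP: (leads_bound (bump_arm G j (e / c)) j w).
  apply/eqP/leadsP => j ji; rewrite /bump_arm eqxx eq_sym (negbTE ji) addr0.
  apply: (le_lt_trans (le_leader_value G w j)); rewrite iE.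
  by rewrite addrAC ltrDl.
apply: (@le_trans _ _ (\sum_i (smoothed_grad eta G i + e / c * (3 / eta)))).
  apply: ler_sum => i _.
  have := smoothed_grad_shift (bump_arm G i (e / c)) i (lexx 1) (ltW ec0).
  rewrite bump_armK => /le_trans; apply; rewrite lerD2l -mulrA ler_wpM2l ?(ltW ec0)//.
  rewrite mulrC ler_wpM2r ?invr_ge0 ?(ltW eta_gt0)//.
  case/andP: (smoothed_grad_bound (bump_arm G i (e / c)) i) => a b.
  have : expR (- 1 ^+ 2 / 2 : R) <= 1 by rewrite -[leRHS]expR0 ler_expR; lra.
  by lra.
rewrite big_split/= lerD2l sumr_const card_ord -[_ *+ N]mulr_natr.
rewrite [leLHS](_ : _ = e)// -[_ * N%:R]mulrA (mulrC (3 / eta)) -/c divfK//.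
by rewrite gt_eqF.
Qed.

End potential.

(** If [p <= q] the cost is at most [p]. If [q < p] the tail is absorbed,
    [(t + 1) * p + q <= (t + 2) * p], and this factor [p] cancels the importance weight [1 / p]. *)
Lemma smoothed_grad_drop G i (t a : R) : 1 <= t -> 0 <= a <= 1 ->
  a * (smoothed_grad eta G i -
       smoothed_grad eta (bump_arm G i (- (a / smoothed_grad eta G i))) i) <=
  expR (- t ^+ 2 / 2) + (t + 2) / eta.
Proof.
move=> t1 /andP[a0 a1]; set p := smoothed_grad eta G i.
set p' := smoothed_grad _ _ _; set q := expR _.
have p0 : 0 <= p := smoothed_grad_ge0 _ _.
have p'0 : 0 <= p' := smoothed_grad_ge0 _ _.
have q0 : 0 < q := expR_gt0 _.
have r0 : 0 <= (t + 2) / eta by rewrite divr_ge0// ?(ltW eta_gt0)//; lra.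
have [pq|qp] := leP p q; first by nra.
have pp : 0 < p := lt_trans q0 qp.
have ap0 : 0 <= a / p by rewrite divr_ge0.
have := smoothed_grad_shift G i t1 ap0; rewrite -/p -/p' -/q => h.
have h1 : p - p' <= a / p / eta * ((t + 2) * p).
  rewrite lerBlDl; apply: (le_trans h); rewrite lerD2l ler_wpM2l//; last by nra.
  by rewrite divr_ge0// ltW.
have E : a / p / eta * ((t + 2) * p) = a * ((t + 2) / eta).
  by field; rewrite !gt_eqF.
rewrite E in h1; apply: (le_trans (ler_wpM2l a0 h1)).
apply: (@le_trans _ _ ((t + 2) / eta)); last by rewrite lerDr ltW.
by rewrite -[leRHS]mul1r [leLHS]mulrA ler_wpM2r// mulr_ile1.
Qed.

End perturbed_leader.

(** * Regret of the algorithm for an arbitrary scale [eta] *)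

Section regret_bound.
Context {R : realType}.
Variables (N T : nat) (eta : R) (g : 'I_T -> 'I_N -> R).
Hypothesis eta_gt0 : 0 < eta.
Hypothesis g_bound : forall u i, -1 <= g u i <= 0.
Local Notation history := {ffun 'I_T -> 'I_N}.
Local Notation p := (smoothed_grad eta).
Implicit Types (f : history) (u : 'I_T) (i k : 'I_N).

Definition set_arm f u i : history := [ffun v => if v == u then i else f v].

(** Exchanging [i] with [f u] is an involution on pairs of a history and an arm; after reindexing,
    the free arm contributes the factor [N]. *)
Lemma sum_set_arm u (F : history -> R) :
  \sum_f \sum_i F (set_arm f u i) = N%:R * \sum_f F f.
Proof.
rewrite pair_bigA /=.
pose phi (x : history * 'I_N) := (set_arm x.1 u x.2, x.1 u).
have phiK : involutive phi.
  move=> [f i]; congr (_, _); last by rewrite ffunE eqxx.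
  by apply/ffunP => v; rewrite !ffunE /=; case: eqP => [->|].
rewrite (reindex_inj (inv_inj phiK)) /=.
rewrite (eq_bigr (fun x => F x.1)) => [|x _]; last first.
  by congr F; exact: (congr1 fst (phiK x)).
rewrite -(pair_bigA _ (fun f i => F f)) /= mulr_sumr.
by apply: eq_bigr => f _; rewrite sumr_const card_ord mulr_natl.
Qed.

Lemma gbpa_Ghat_set_arm f u i (t : nat) : (t <= u)%N ->
  gbpa_Ghat eta g (set_arm f u i) t = gbpa_Ghat eta g f t.
Proof.
elim: t => [//|t IH] tu /=; rewrite (IH (ltnW tu)).
case: insubP => // v _ vt; rewrite ffunE.
by have -> : (v == u) = false by rewrite -(inj_eq val_inj) vt ltn_eqF.
Qed.

Lemma gbpa_GhatS f u : gbpa_Ghat eta g f u.+1 =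
  bump_arm (gbpa_Ghat eta g f u) (f u)
    (g u (f u) / p (gbpa_Ghat eta g f u) (f u)).
Proof.
rewrite /= valK; apply/funext => j; rewrite /bump_arm.
by case: eqP => [->|].
Qed.

(** Histories keep their full length [T]; only the first [t] choices carry weight. *)
Definition prefix_prob (t : nat) f : R :=
  \prod_(u : 'I_T | (u < t)%N) p (gbpa_Ghat eta g f u) (f u).

Lemma prefix_prob_ge0 t f : 0 <= prefix_prob t f.
Proof. by apply: prodr_ge0 => u _; exact: smoothed_grad_ge0. Qed.

Lemma prefix_prob_set_arm f u i : prefix_prob u.+1 (set_arm f u i) =
  prefix_prob u f * p (gbpa_Ghat eta g f u) i.
Proof.
rewrite /prefix_prob (bigD1 u) ?leqnn//= mulrC; congr (_ * _); last first.
  by rewrite gbpa_Ghat_set_arm// ffunE eqxx.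
apply: eq_big => v; first by rewrite ltnS [RHS]ltn_neqAle andbC -val_eqE.
rewrite ltnS => /andP[vu vneq]; rewrite gbpa_Ghat_set_arm//.
by rewrite ffunE (negbTE vneq).
Qed.

(* The [T - t] rounds that carry no weight yet are summed freely, so both sides
   are [N ^ T] times an expectation. *)
Lemma supermartingale_sum (Y : nat -> history -> R) :
  (forall u f, \sum_i p (gbpa_Ghat eta g f u) i * Y u.+1 (set_arm f u i) <= Y u f) ->
  forall t, (t <= T)%N ->
  N%:R ^+ t * \sum_f prefix_prob t f * Y t f <= \sum_f Y 0%N f.
Proof.
move=> hY; elim=> [_|t IH tT].
  rewrite expr0 mul1r; under eq_bigr do rewrite /prefix_prob big_pred0_eq mul1r.
  exact: lexx.
apply: (le_trans _ (IH (ltnW tT))); rewrite exprSr -mulrA ler_wpM2l ?exprn_ge0//.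
pose u := Ordinal tT; rewrite -(sum_set_arm u); apply: ler_sum => f _.
rewrite -[t.+1]/((u : nat).+1).
under eq_bigr do rewrite prefix_prob_set_arm -mulrA.
by rewrite -mulr_sumr ler_wpM2l ?prefix_prob_ge0// hY.
Qed.

(** The level [t] controls the initial potential and [t'] the drop of probability in each round. *)
Lemma gbpa_regret_arm k (t t' : R) : 1 <= t -> 1 <= t' ->
  \sum_f gbpa_prob eta g f * (\sum_u (g u k - g u (f u))) <=
  eta * (t + N%:R * expR (- t ^+ 2 / 2)) +
  T%:R * (N%:R * (expR (- t' ^+ 2 / 2) + (t' + 2) / eta)).
Proof.
move=> t1 t'1; set b := expR _ + _ / _.
have b0 : 0 <= b.
  by rewrite addr_ge0 ?expR_ge0// divr_ge0// ?(ltW eta_gt0)//; lra.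
pose Phi := potential eta k.
pose Gh f (s : nat) := gbpa_Ghat eta g f s.
(* Regret so far against [k], plus the gap between the potential and the estimate for [k], plus a
   budget [N * b] per remaining round. The gap is nonnegative by [le_potential], so at time [T] this
   dominates the regret. *)
pose Y (s : nat) f := \sum_(u : 'I_T | (u < s)%N) (g u k - g u (f u)) +
  (Phi (Gh f s) - Gh f s k) + (T%:R - s%:R) * (N%:R * b).
have step u f : \sum_i p (Gh f u) i * Y u.+1 (set_arm f u i) <= Y u f.
  set G := Gh f u; pose s i := g u i / p G i.
  have YS i : Y u.+1 (set_arm f u i) = Y u f + (g u k - g u i +
      (Phi (bump_arm G i (s i)) - Phi G) - (if i == k then s i else 0) - N%:R * b).
    have GS : Gh (set_arm f u i) u.+1 = bump_arm G i (s i).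
      by rewrite /Gh gbpa_GhatS gbpa_Ghat_set_arm// ffunE eqxx.
    rewrite /Y GS (bigD1 u) ?leqnn//= {1}/set_arm ffunE eqxx.
    have -> : \sum_(v < T | (v < u.+1)%N && (v != u)) (g v k - g v (set_arm f u i v))
            = \sum_(v < T | (v < u)%N) (g v k - g v (f v)).
      apply: eq_big => v; first by rewrite ltnS [RHS]ltn_neqAle andbC -val_eqE.
      by case/andP=> _ /negbTE vu; rewrite ffunE vu.
    have -> : bump_arm G i (s i) k = G k + (if i == k then s i else 0) by [].
    rewrite -/G -[u.+1%:R]natr1; set S := \sum_(v < T | (v < u)%N) _.
    by set c := if _ then _ else _; set x := u%:R; ring.
  under eq_bigr do rewrite YS mulrDr.
  rewrite big_split/= -mulr_suml (smoothed_grad_sum eta_gt0 k) mul1r.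
  rewrite -[leRHS]addr0 lerD2l.
  have p0 i : 0 <= p G i by exact: smoothed_grad_ge0.
  have term i : p G i * (g u k - g u i + (Phi (bump_arm G i (s i)) - Phi G) -
        (if i == k then s i else 0) - N%:R * b) <=
      p G i * (g u k - N%:R * b) - (if i == k then g u i else 0) + b.
    have /andP[gi1 gi0] := g_bound u i.
    have s0 : s i <= 0 by rewrite /s mulr_le0_ge0// invr_ge0.
    have h1 := potential_bump eta_gt0 k G i s0.
    have h2 : p G i * (s i * p (bump_arm G i (s i)) i - g u i) <= b.
      have [pz|pz] := eqVneq (p G i) 0; first by rewrite pz mul0r.
      have ha : 0 <= - g u i <= 1 by apply/andP; split; lra.
      have := smoothed_grad_drop eta_gt0 G i t'1 ha; rewrite -/b.
      rewrite (_ : - (- g u i / p G i) = s i); last by rewrite mulNr opprK.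
      set p' := p (bump_arm _ _ _) i.
      by apply: le_trans; rewrite /s le_eqVlt; apply/orP; left; apply/eqP; field.
    (* The estimate is unbiased where [p G i] is nonzero. Where it vanishes the left side is 0, and
       the sign [g u i <= 0] gives the inequality. *)
    have h3 : - (p G i * (if i == k then s i else 0)) <= - (if i == k then g u i else 0).
      case: ifP => _; last by rewrite mulr0.
      rewrite lerN2 /s; have [->|pz] := eqVneq (p G i) 0; first by rewrite mul0r.
      by rewrite mulrC divfK.
    have := ler_wpM2l (p0 i) h1; rewrite -/Phi; lra.
  (* These bounds add up to 0: the probabilities sum to 1, [g u k] cancels, and the [N] copies of
     [b] use up the budget of the round. *)
  apply: (le_trans (ler_sum _ (fun i _ => term i))).
  rewrite big_split/= sumr_const card_ord sumrB -mulr_suml.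
  rewrite (smoothed_grad_sum eta_gt0 k) mul1r -big_mkcond big_pred1_eq -mulr_natl.
  lra.
have N0 : 0 < N%:R :> R by rewrite ltr0n (leq_trans _ (ltn_ord k)).
rewrite -(ler_pM2l (exprn_gt0 T N0)).
apply: (@le_trans _ _ (N%:R ^+ T * \sum_f prefix_prob T f * Y T f)).
  rewrite ler_wpM2l ?exprn_ge0 ?(ltW N0)//; apply: ler_sum => f _.
  have -> : gbpa_prob eta g f = prefix_prob T f.
    by apply: eq_bigl => u; rewrite ltn_ord.
  rewrite ler_wpM2l ?prefix_prob_ge0// /Y subrr mul0r addr0.
  rewrite [X in _ <= X + _](_ : _ = \sum_u (g u k - g u (f u))).
    by rewrite lerDl subr_ge0; exact: le_potential.
  by apply: eq_bigl => u; rewrite ltn_ord.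
apply: (le_trans (supermartingale_sum step (leqnn T))).
have Y0 f : Y 0%N f = Phi (fun=> 0) + T%:R * (N%:R * b).
  by rewrite /Y big_pred0_eq /Gh /= add0r !subr0.
under eq_bigr do rewrite Y0.
rewrite sumr_const card_ffun !card_ord -[_ *+ (N ^ T)]mulr_natl natrX ler_wpM2l ?exprn_ge0//.
by rewrite lerD2r; exact: potential0_le.
Qed.

(** The gains are fixed in advance, so a single arm [k] attains the maximum in the regret of every
    history. *)
Lemma gbpa_expected_regret_le (t t' : R) : (0 < N)%N -> 1 <= t -> 1 <= t' ->
  (gbpa_expected_regret eta g <=
    (eta * (t + N%:R * expR (- t ^+ 2 / 2)) +
     T%:R * (N%:R * (expR (- t' ^+ 2 / 2) + (t' + 2) / eta)))%:E)%E.
Proof.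
move=> N0 t1 t'1.
pose S i := \sum_u g u i.
have [k _ hk] := arg_maxP S (isT : xpredT (Ordinal N0)).
apply: (@le_trans _ _ (\sum_f gbpa_prob eta g f * (\sum_u (g u k - g u (f u))))%:E).
  rewrite /gbpa_expected_regret -sumEFin; apply: lee_sum => f _.
  rewrite EFinM lee_wpmul2l ?lee_fin//.
    by apply: prodr_ge0 => u _; exact: smoothed_grad_ge0.
  apply: bigmax_le => [|i _]; first exact: leNye.
  by rewrite lee_fin !sumrB lerD2r; exact: hk.
by rewrite lee_fin; exact: gbpa_regret_arm.
Qed.

End regret_bound.

(** * Numerical estimates for the prescribed [eta] *)

Section tuning.
Context {R : realType}.

(** The twelfth power of [7 / 8 <= expR (- (1 / 8))] is enough, as [(7 / 8) ^+ 12] exceeds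
    [1 / 5]. *)
Lemma expR_3half_le : expR (3 / 2 : R) <= 5.
Proof.
have h : 7 / 8 <= expR (- (1 / 8) : R) by have := expR_ge1Dx (- (1 / 8) : R); lra.
have E : expR (- (3 / 2) : R) = expR (- (1 / 8)) ^+ 12.
  by rewrite -expRM_natl; congr expR; lra.
have : (7 / 8 : R) ^+ 12 <= expR (- (3 / 2)) by rewrite E lerXn2r// ?nnegrE; lra.
rewrite expRN => h2; rewrite -[leRHS]invrK -[leLHS]invrK lef_pV2 ?posrE ?invr_gt0 ?expR_gt0//.
by apply: le_trans h2; lra.
Qed.

Lemma expR_half_le : expR (1 / 2 : R) <= 2.
Proof.
have h : 1 / 2 <= expR (- (1 / 2) : R) by have := expR_ge1Dx (- (1 / 2) : R); lra.
rewrite -[leRHS]invrK -[leLHS]invrK lef_pV2 ?posrE ?invr_gt0 ?expR_gt0//.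
by rewrite -expRN; lra.
Qed.

Lemma half_le_ln (n : R) : 2 <= n -> 1 / 2 <= ln n.
Proof.
move=> n2; rewrite -[leLHS]expRK ler_ln ?posrE ?expR_gt0//; last by lra.
exact: le_trans expR_half_le n2.
Qed.

Lemma three_half_le_ln (n : R) : 5 <= n -> 3 / 2 <= ln n.
Proof.
move=> n5; rewrite -[leLHS]expRK ler_ln ?posrE ?expR_gt0//; last by lra.
exact: le_trans expR_3half_le n5.
Qed.

Lemma expR_sqrt_ln (x : R) : 1 <= x -> expR (- Num.sqrt (2 * ln x) ^+ 2 / 2) = x^-1.
Proof.
move=> x1; rewrite sqr_sqrtr ?mulr_ge0 ?ln_ge0//.
rewrite (_ : - (2 * ln x) / 2 = - ln x); last by lra.
by rewrite expRN lnK// posrE (lt_le_trans _ x1).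
Qed.

Lemma sqrt_le_lin (a b : R) : 0 <= b -> a <= b ^+ 2 -> Num.sqrt a <= b.
Proof.
by move=> b0 ab; rewrite -[leRHS]ger0_norm// -sqrtr_sqr ler_wsqrtr.
Qed.

(** [K], [P], [r], [L] stand for the factors of the final bound and [sX] for the square root of the
    base of the power defining [eta]. The constant is 5 times 3 times 3, with
    [t + 1 <= 2 * t <= 3 * r]. *)
Lemma perturbation_cost_le (eta t K P r L sX : R) : 0 < eta -> 1 <= t ->
  0 <= P -> t <= 3 / 2 * r -> eta <= sX * P * 5 -> sX <= 3 * K * L ->
  eta * (t + 1) <= 45 * K * P * r * L.
Proof.
move=> eta0 t1 P0 t_le eta_le sX_le.
apply: (@le_trans _ _ ((sX * P * 5) * (3 * r))).
  by apply: ler_pM => //; lra.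
rewrite (_ : 45 * K * P * r * L = (3 * K * L) * P * 5 * (3 * r)); last by ring.
by rewrite ler_wpM2r ?ler_wpM2r//; lra.
Qed.

(** As [n * tau] is [K ^+ 2] and [K <= sX * (t / 2) <= eta * (t / 2)], dividing by [eta] leaves
    [K * (t / 2)]. The logarithm [l] hidden in [t'] is absorbed by [L + l <= L * P]. *)
Lemma divergence_cost_le (n tau eta t t' K P r L l sX : R) :
  0 < eta -> 3 / 2 <= L -> 1 / 2 <= l -> 1 <= t -> 1 <= t' -> 1 <= K ->
  K ^+ 2 = n * tau -> 1 / 2 <= r -> t <= 3 / 2 * r -> t' ^+ 2 = 2 * (l + L) ->
  L + l <= L * P -> sX <= eta -> K <= sX * (t / 2) ->
  tau * (n * ((t' + 2) / eta)) <= 2 * K * P * r * L.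
Proof.
move=> eta0 L_ge l_ge t1 t'1 K1 KK r_ge t_le tt LP eta_ge K_le.
apply: (@le_trans _ _ (K * ((t / 2) * (t' + 2)))).
  rewrite (_ : tau * _ = K * (K * (t' + 2)) / eta); last first.
    by rewrite [K * _]mulrA -expr2 KK; ring.
  rewrite ler_pdivrMr// -[leRHS]mulrA; apply: ler_wpM2l; first by clear -K1; lra.
  rewrite [leRHS]mulrAC; apply: ler_wpM2r; first by clear -t'1; lra.
  apply: (le_trans K_le); rewrite mulrC; apply: ler_wpM2l => //.
  by clear -t1; lra.
rewrite (_ : 2 * K * P * r * L = K * (2 * r * (L * P))); last by ring.
apply: ler_wpM2l; first by clear -K1; lra.
apply: (@le_trans _ _ (3 / 4 * r * (t' + 2))).
  by apply: ler_wpM2r; [clear -t'1|clear -t_le]; lra.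
apply: (@le_trans _ _ (2 * r * (L + l))); last first.
  by apply: ler_wpM2l => //; clear -r_ge; lra.
have h : t' <= 1 / 2 + (l + L) by have := sqr_ge0 (t' - 1); clear -tt; nra.
rewrite [leLHS](_ : _ = r * (3 / 4 * (t' + 2))); last by ring.
rewrite [leRHS](_ : _ = r * (2 * (L + l))); last by ring.
by apply: ler_wpM2l; [clear -r_ge|clear -h L_ge l_ge]; lra.
Qed.

Lemma one_le_cost (K P r L : R) : 1 <= K -> 1 <= P -> 1 / 2 <= r -> 3 / 2 <= L ->
  1 <= 2 * K * P * r * L.
Proof.
move=> K1 P1 r_ge L_ge.
have h1 : 1 <= K * P by clear -K1 P1; nra.
have h2 : 1 / 2 <= r * L by clear -r_ge L_ge; nra.
rewrite (_ : 2 * K * P * r * L = 2 * ((K * P) * (r * L))); last by ring.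
by move: h1 h2; clear; move: (K * P) (r * L) => a b; nra.
Qed.

(** With [X] the base of the power, [eta] lies between [Num.sqrt X] and [5 * P * Num.sqrt X]; each
    cost uses one side. The constant 49 is 45 for the potential, 2 for the shifts and 2 for the tail
    term, which equals 1. *)
Lemma gaussian_tuning (n tau eta : R) : 2 <= n -> 5 <= tau ->
  let alpha := 1 / ln tau in
  eta = ((4 * n * tau) / (alpha * (1 - alpha) * Num.sqrt (2 * ln n)))
          `^ (1 / (2 - alpha)) ->
  let t := Num.sqrt (2 * ln n) in let t' := Num.sqrt (2 * ln (n * tau)) in
  [/\ 0 < eta, 1 <= t, 1 <= t' &
    eta * (t + n * expR (- t ^+ 2 / 2)) +
      tau * (n * (expR (- t' ^+ 2 / 2) + (t' + 2) / eta)) <=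
    49 * Num.sqrt (n * tau) * (n `^ (1 / ln tau)) * Num.sqrt (ln n) * ln tau].
Proof.
move=> n2 tau5 alpha etaE t t'.
have l_ge := half_le_ln n2; have L_ge := three_half_le_ln tau5.
have lntau := ln_sublinear (lt_le_trans (ltr0n R 5) tau5).
set l := ln n in l_ge *; set L := ln tau in L_ge lntau *.
have n0 : 0 < n by lra. have tau0 : 0 < tau by lra.
have ntau1 : 1 <= n * tau by nra.
have ntau0 : 0 < n * tau by lra.
have lnn : ln (n * tau) = l + L by rewrite lnM ?posrE.
have t1 : 1 <= t by rewrite -[leLHS]sqrtr1 ler_wsqrtr// -/l; lra.
have t'1 : 1 <= t' by rewrite -[leLHS]sqrtr1 ler_wsqrtr// lnn; lra.
have t0 : 0 < t by lra.
pose K := Num.sqrt (n * tau); pose P := n `^ (1 / L); pose r := Num.sqrt l.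
have K1 : 1 <= K by rewrite -[leLHS]sqrtr1 ler_wsqrtr.
have KK : K ^+ 2 = n * tau by rewrite sqr_sqrtr// ltW.
have r_ge : 1 / 2 <= r.
  rewrite -[leLHS]ger0_norm; last by lra.
  by rewrite -sqrtr_sqr ler_wsqrtr//; lra.
have rr : r ^+ 2 = l by rewrite sqr_sqrtr//; lra.
have t_le : t <= 3 / 2 * r.
  by apply: sqrt_le_lin; [lra|rewrite exprMn rr -/l; lra].
have tt : t ^+ 2 = 2 * l by rewrite sqr_sqrtr// -/l; lra.
have t't' : t' ^+ 2 = 2 * (l + L) by rewrite sqr_sqrtr lnn//; lra.
have PE : P = expR (l / L).
  by rewrite /P /powR gt_eqF// -/l; congr expR; rewrite mulrC mulrA mulr1.
have LP : L + l <= L * P.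
  rewrite PE; have := expR_ge1Dx (l / L).
  rewrite -(ler_pM2l (_ : 0 < L)); last by lra.
  by rewrite mulrDr mulr1 mulrCA divff ?mulr1//; lra.
have P1 : 1 <= P by rewrite PE (le_trans _ (expR_ge1Dx _))// lerDl divr_ge0; lra.
pose X := (4 * n * tau) / (alpha * (1 - alpha) * t).
have XE : X = 4 * K ^+ 2 * (L ^+ 2 / ((L - 1) * t)).
  by rewrite KK /X /alpha -/L; field; rewrite !gt_eqF//; lra.
have K40 : 0 <= 4 * K ^+ 2 by rewrite mulr_ge0 ?sqr_ge0.
(* This form yields [K_le] below: multiplied by [t ^+ 2 / 4] it leaves [K ^+ 2 * L], and
   [L >= 1]. *)
have X_ge : 4 * K ^+ 2 * (L / t ^+ 2) <= X.
  rewrite XE; apply: ler_wpM2l => //.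
  have Lt0 : 0 < (L - 1) * t by rewrite mulr_gt0//; lra.
  rewrite ler_pdivrMr ?exprn_gt0// mulrAC ler_pdivlMr//.
  have : 1 <= t * L by nra.
  rewrite (_ : L * ((L - 1) * t) = L * t * (L - 1)); last by ring.
  rewrite (_ : L ^+ 2 * t ^+ 2 = L * t * (t * L)); last by ring.
  by move=> h; apply: ler_wpM2l; nra.
(* Here [L >= 3 / 2] gives [L <= 3 * (L - 1)]. *)
have X_le : X <= 12 * K ^+ 2 * L.
  rewrite XE -[12 * _ * _]mulrA [12 * _](_ : _ = 4 * K ^+ 2 * (3 * L)); last by ring.
  apply: ler_wpM2l => //.
  have Lt0 : 0 < (L - 1) * t by rewrite mulr_gt0//; lra.
  rewrite ler_pdivrMr//.
  have : L * 1 <= 3 * (L - 1) * t by apply: ler_pM; lra.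
  nra.
have X1 : 1 <= X.
  apply: (le_trans _ X_ge); rewrite mulrA ler_pdivlMr ?exprn_gt0// mul1r tt KK.
  have := ln_sublinear n0; rewrite -/l => ln_n; nra.
have X0 : 0 < X by lra.
have lnX0 : 0 <= ln X by exact: ln_ge0.
have lnX_le : ln X <= l + 4 * L.
  have -> : l + 4 * L = ln (n * tau ^+ 4).
    by rewrite lnM ?posrE ?exprn_gt0// lnXn// mulr_natl.
  have nt0 : 0 < n * tau ^+ 4 by rewrite mulr_gt0 ?exprn_gt0.
  rewrite ler_ln ?posrE//; apply: (le_trans X_le); rewrite KK.
  have : 12 * L <= tau ^+ 3.
    apply: (@le_trans _ _ (tau ^+ 2 * tau)); last by rewrite -exprSr.
    by apply: ler_pM => //; [lra|nra|exact: ltW].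
  have : 0 < n * tau by [].
  rewrite (_ : n * tau ^+ 4 = n * tau * tau ^+ 3); last by ring.
  move: (n * tau) (tau ^+ 3) => a c; nra.
pose sX := Num.sqrt X.
have sX1 : 1 <= sX by rewrite -[leLHS]sqrtr1 ler_wsqrtr.
have sXX : sX ^+ 2 = X by rewrite sqr_sqrtr// ltW.
have sXE : sX = expR (ln X / 2).
  have h : expR (ln X / 2) ^+ 2 = X.
    by rewrite -expRM_natl (_ : 2%:R * (ln X / 2) = ln X) ?lnK ?posrE//; lra.
  by rewrite /sX -{1}h sqrtr_sqr ger0_norm ?expR_ge0.
have etaX : eta = expR (ln X / (2 - alpha)).
  rewrite etaE -/t -/X /powR gt_eqF//; congr expR.
  by rewrite mulrC mulrA mulr1.
have L0 : 0 < L by lra.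
have alpha0 : 0 < alpha by rewrite /alpha divr_gt0.
have alpha_le : alpha <= 2 / 3 by rewrite /alpha -/L ler_pdivrMr//; lra.
have aL : alpha * L = 1 by rewrite /alpha -/L divfK// gt_eqF.
have eta_ge : sX <= eta.
  by rewrite sXE etaX ler_expR ler_wpM2l// lef_pV2 ?posrE; lra.
have eta0 : 0 < eta by lra.
(* The exponents differ by [alpha * ln X / (2 * (2 - alpha))]. Since [alpha * L = 1],
   [alpha * ln X <= alpha * l + 4], and [2 - alpha >= 4 / 3]; the part with [l] goes into [P], and
   the rest is at most [3 / 2]. *)
have eta_le : eta <= sX * P * 5.
  apply: (@le_trans _ _ (sX * P * expR (3 / 2))); last first.
    by rewrite ler_wpM2l ?expR_3half_le// mulr_ge0; lra.
  rewrite sXE PE -!expRD etaX ler_expR.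
  rewrite ler_pdivrMr; last by lra.
  have -> : l / L = alpha * l by rewrite /alpha -/L mul1r mulrC.
  have : alpha * ln X <= alpha * l + 4.
    have := ler_wpM2l (ltW alpha0) lnX_le; lra.
  have : 0 <= alpha * l by nra.
  move: (alpha * l) (ln X) => x y x0 xy.
  have : 4 / 3 * (x + 3 / 2) <= (2 - alpha) * (x + 3 / 2) by apply: ler_wpM2r; lra.
  lra.
have sX_le : sX <= 3 * K * L.
  by apply: sqrt_le_lin; [nra|apply: (le_trans X_le); rewrite !exprMn; nra].
have K_le : K <= sX * (t / 2).
  apply: sqrt_le_lin; first by nra.
  rewrite -KK exprMn sXX exprMn tt.
  have : 4 * K ^+ 2 * L <= X * (2 * l).
    by rewrite -tt -ler_pdivrMr ?exprn_gt0//; apply: le_trans X_ge; rewrite [leRHS]mulrA.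
  nra.
split=> //; rewrite /t !expR_sqrt_ln//; last by lra.
rewrite -/t -/t' divff ?gt_eqF//.
rewrite -/K -/P -/r -/L.
have first_term : eta * (t + 1) <= 45 * K * P * r * L.
  exact: (perturbation_cost_le eta0 t1 (le_trans ler01 P1) t_le eta_le sX_le).
have second_term : tau * (n * ((t' + 2) / eta)) <= 2 * K * P * r * L.
  exact: (divergence_cost_le eta0 L_ge l_ge t1 t'1 K1 KK r_ge t_le t't' LP eta_ge K_le).
have third_term := one_le_cost K1 P1 r_ge L_ge.
have -> : tau * (n * ((n * tau)^-1 + (t' + 2) / eta)) =
    1 + tau * (n * ((t' + 2) / eta)).
  by rewrite mulrDr mulrDr mulrA (mulrC tau) divff ?gt_eqF.
move: first_term second_term third_term; clear.
by move: (eta * _) (tau * _) => x y; lra.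
Qed.

End tuning.

(** * The two stated bounds, with their constants *)

Unset Implicit Arguments.

Theorem theorem4 (R : realType) (N T : nat) (hN : (2 <= N)%N) (hT : (4 < T)%N)
  (alpha eta : R)
  (halpha : alpha = 1 / ln (T%:R : R))
  (heta : eta = ((4 * N%:R * T%:R) /
                 (alpha * (1 - alpha) * Num.sqrt (2 * ln (N%:R : R))))
                `^ (1 / (2 - alpha)))
  (g : 'I_T -> 'I_N -> R) (hg : forall t i, -1 <= g t i <= 0) :
  (gbpa_expected_regret eta g <=
     (96 * Num.sqrt (N%:R * T%:R) * (N%:R `^ (1 / ln (T%:R : R)))
        * Num.sqrt (ln (N%:R : R)) * ln (T%:R : R))%:E)%E /\
  ((N < T)%N ->
   (gbpa_expected_regret eta g <=
     (278 * Num.sqrt (N%:R * T%:R) * Num.sqrt (ln (N%:R : R)) * ln (T%:R : R))%:E)%E).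
Proof.
have n2 : 2 <= N%:R :> R by rewrite ler_nat.
have tau5 : 5 <= T%:R :> R by rewrite ler_nat.
rewrite halpha in heta.
have [eta0 t1 t'1 le49] := gaussian_tuning n2 tau5 heta.
have N0 : (0 < N)%N := ltnW hN.
have le_regret := gbpa_expected_regret_le eta0 hg N0 t1 t'1.
have L0 := three_half_le_ln tau5.
set K := Num.sqrt (N%:R * T%:R) in le49 *; set r := Num.sqrt (ln N%:R) in le49 *.
set P := N%:R `^ _ in le49 *; set L := ln T%:R in L0 P le49 *.
have KrL0 : 0 <= K * r * L by rewrite !mulr_ge0 ?sqrtr_ge0//; lra.
have P0 : 0 <= P by exact: powR_ge0.
split=> [|NT]; apply: (le_trans le_regret); rewrite lee_fin; apply: (le_trans le49).
  have := mulr_ge0 KrL0 P0; lra.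
(* For [N < T] the exponent [ln N / ln T] is at most 1, so [P] is bounded by a constant, and 49
   times 5 stays below 278. *)
have P5 : P <= 5.
  apply: le_trans expR_3half_le; rewrite /P /powR gt_eqF ?ler_expR ?ltr0n//.
  have : ln (N%:R : R) <= L by rewrite ler_ln ?posrE ?ltr0n ?(ltn_trans _ hT)// ler_nat ltnW.
  move=> lL; apply: (@le_trans _ _ 1); last by lra.
  by rewrite mulrC mulrA mulr1 ler_pdivrMr ?mul1r//; lra.
have := ler_wpM2l KrL0 P5; lra.
Qed.
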